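(* Let $(X,\Sigma_X,\mu)$ and $(Y,\Sigma_Y,\nu)$ be measure spaces such that the pair $(\mu,\nu)$ is abelian. If the function $f:X\times Y\to[0,+\infty]$ is $(\Sigma_X\otimes\Sigma_Y)$-measurable, then $$\int_{X\times Y} f\,d(\mu\otimes\nu)=\int_X\left(\int_Y f(x,y)\,d\nu(y)\right)d\mu(x)=\int_Y\left(\int_X f(x,y)\,d\mu(x)\right)d\nu(y).$$
   Context: No finiteness or $\sigma$-finiteness assumptions are made on the measures. $\Sigma_X\otimes\Sigma_Y$ denotes the $\sigma$-algebra on $X\times Y$ generated by the measurable rectangles $E\times F$ with $E\in\Sigma_X$, $F\in\Sigma_Y$. For $A\subseteq X\times Y$, write $A^y=\{x\in X\mid (x,y)\in A\}$ and $A_x=\{y\in Y\mid (x,y)\in A\}$. The pair $(\mu,\nu)$ is called abelian if for every $A\in\Sigma_X\otimes\Sigma_Y$: (i) $y\mapsto\mu(A^y)$ is $\Sigma_Y$-measurable; (ii) $x\mapsto\nu(A_x)$ is $\Sigma_X$-measurable; (iii) $\int_Y\mu(A^y)\,d\nu(y)=\int_X\nu(A_x)\,d\mu(x)$ (as elements of $[0,+\infty]$). For an abelian pair $(\mu,\nu)$ the product measure $\mu\otimes\nu$ on $\Sigma_X\otimes\Sigma_Y$ is defined by $(\mu\otimes\nu)(A)=\int_X\nu(A_x)\,d\mu(x)=\int_Y\mu(A^y)\,d\nu(y)$; it is a measure. *)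

(* Defs.v *)
From HB Require Import structures.
From mathcomp Require Import all_boot all_order all_algebra.
From mathcomp Require Import all_classical all_reals all_analysis.
From mathcomp Require Import measurable_realfun.

Set Implicit Arguments.
Unset Strict Implicit.
Unset Printing Implicit Defensive.

Import Order.TTheory GRing.Theory Num.Theory.
Local Open Scope classical_set_scope.
Local Open Scope ring_scope.
Local Open Scope ereal_scope.

(* The library's sigma-algebra on [X * Y] is generated by the preimages of
   measurable sets under the two projections; by
   [measurable_prod_measurableType] it is the one generated by the measurable
   rectangles. [ysection A y] is A^y and [xsection A x] is A_x. *)
Definition abelian_pair dX dY (X : measurableType dX) (Y : measurableType dY)
    (R : realType) (mu : {measure set X -> \bar R})
    (nu : {measure set Y -> \bar R}) : Prop :=
  forall A : set (X * Y), measurable A ->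
    [/\ measurable_fun [set: Y] (mu \o ysection A),
        measurable_fun [set: X] (nu \o xsection A) &
        \int[nu]_y mu (ysection A y) = \int[mu]_x nu (xsection A x)].

(* The library makes [mu \x nu] a measure only when [nu] is sigma-finite.
   Carrying the proof [h] as an argument allows a measure structure to be
   attached to the product of an arbitrary abelian pair. *)
Definition abelian_product dX dY (X : measurableType dX)
    (Y : measurableType dY) (R : realType) (mu : {measure set X -> \bar R})
    (nu : {measure set Y -> \bar R}) (h : abelian_pair mu nu) :
    set (X * Y) -> \bar R :=
  fun A => \int[mu]_x nu (xsection A x).

Section abelian_product_measure.
Context dX dY (X : measurableType dX) (Y : measurableType dY) (R : realType).
Context (mu : {measure set X -> \bar R}) (nu : {measure set Y -> \bar R}).
Context (h : abelian_pair mu nu).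

Lemma abelian_productE (A : set (X * Y)) : measurable A ->
  abelian_product h A = \int[nu]_y mu (ysection A y).
Proof. by move=> /h[_ _ ->]. Qed.

Let prod0 : abelian_product h set0 = 0.
Proof.
by rewrite /abelian_product integral0_eq// => x _; rewrite xsection0 measure0.
Qed.

Let prod_ge0 A : 0 <= abelian_product h A.
Proof. by apply: integral_ge0 => x _; exact: measure_ge0. Qed.

Let prod_sigma_additive : semi_sigma_additive (abelian_product h).
Proof.
move=> F mF tF mUF.
rewrite [X in _ --> X](_ : _ = \sum_(n <oo) abelian_product h (F n)).
  by apply/cvg_closeP; split; [exact: is_cvg_nneseries|rewrite closeE].
rewrite /abelian_product -integral_nneseries//; last first.
  by move=> n; have [] := h (mF n).
apply: eq_integral => x _; apply/esym/cvg_lim => //=; rewrite xsection_bigcup.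
apply: (measure_sigma_additive _ (trivIset_xsection tF)) => i.
exact: measurable_xsection.
Qed.

HB.instance Definition _ := isMeasure.Build _ _ _ (abelian_product h)
  prod0 prod_ge0 prod_sigma_additive.

End abelian_product_measure.

(* Main.v *)
(* Both iterated integrals are integrals against a mixture of measures,
   [lam A = \int[mu]_x K x A], where [K x] is the image of [nu] under
   [y |-> (x, y)] (resp. the image of [mu] under [x |-> (x, y)]). Being abelian
   says that the two mixtures agree with the product measure, and monotone
   approximation by simple functions yields [\int[lam] f = \int[mu]_x \int[K x] f]
   for any mixture whatsoever: sigma-finiteness only ever serves to obtain the
   measurability of the sections and the equality of the two mixtures. *)
Require Import Defs.
From HB Require Import structures.
From mathcomp Require Import all_boot all_order all_algebra.
From mathcomp Require Import all_classical all_reals all_analysis.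
From mathcomp Require Import measurable_realfun.

Set Implicit Arguments.
Unset Strict Implicit.
Unset Printing Implicit Defensive.

Import Order.TTheory GRing.Theory Num.Theory.
Local Open Scope classical_set_scope.
Local Open Scope ring_scope.
Local Open Scope ereal_scope.

Section integral_mixture.
Context dX dZ (X : measurableType dX) (Z : measurableType dZ) (R : realType).
Variables (mu : {measure set X -> \bar R}) (lam : {measure set Z -> \bar R}).
Variable K : X -> {measure set Z -> \bar R}.
Hypothesis mK : forall A, measurable A -> measurable_fun [set: X] (K ^~ A).
Hypothesis lamE : forall A, measurable A -> lam A = \int[mu]_x K x A.

Import HBNNSimple.

(** A simple integral is a finite sum over level sets: it commutes with the integral in [x], and
    [lamE] applies to each level set. *)
Lemma sintegral_mixture (h : {nnsfun Z >-> R}) :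
  sintegral lam h = \int[mu]_x sintegral (K x) h.
Proof.
under eq_integral do rewrite sintegralE.
rewrite ge0_integral_fsum//; last 2 first.
  by move=> r; apply: measurable_funeM; exact: mK.
  (* Here [r] may be negative, but then its level set is empty. *)
  by move=> r x _; exact: nnsfun_mulemu_ge0.
rewrite sintegralE /=; apply: eq_fsbigr => r; rewrite inE => -[z _ <-].
by rewrite ge0_integralZl ?lamE// ?lee_fin//; exact: mK.
Qed.

Lemma ge0_integral_mixture (f : Z -> \bar R) :
    measurable_fun [set: Z] f -> (forall z, 0 <= f z) ->
  \int[lam]_z f z = \int[mu]_x \int[K x]_z f z.
Proof.
move=> mf f0.
pose g := nnsfun_approx measurableT mf.
pose gE n := EFin \o g n.
have mgE n : measurable_fun [set: Z] (gE n) by exact/measurable_EFinP.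
have gE0 n z : 0 <= gE n z by rewrite lee_fin.
have nd_gE z : {homo gE ^~ z : n m / (n <= m)%O >-> n <= m}.
  by move=> *; exact/lefP/nd_nnsfun_approx.
(* Kept general in [m]: the same approximations [gE] serve [lam] and every [K x]. *)
have limE (m : {measure set Z -> \bar R}) :
    \int[m]_z f z = limn (fun n => \int[m]_z gE n z).
  rewrite -monotone_convergence//; apply: eq_integral => z _.
  by apply/esym/cvg_lim => //; exact: cvg_nnsfun_approx.
rewrite limE; under eq_integral do rewrite limE.
(* Monotone convergence once more, now for [mu] and the inner integrals of [gE n]. *)
rewrite monotone_convergence//.
- apply: congr_lim; apply/funext => n.
  rewrite integralT_nnsfun sintegral_mixture; apply: eq_integral => x _.
  by rewrite integralT_nnsfun.
- by move=> n; exact: measurable_fun_integral_kernel.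
- by move=> n x _; exact: integral_ge0.
- by move=> x _ m n mn; apply: ge0_le_integral => // z _; exact: nd_gE.
Qed.

End integral_mixture.

(* [p] is kept abstract so as to cover both [(x, y)] and its transpose. *)
Lemma ge0_integral_disintegration dX dY dZ (X : measurableType dX)
    (Y : measurableType dY) (Z : measurableType dZ) (R : realType)
    (mu : {measure set X -> \bar R}) (nu : {measure set Y -> \bar R})
    (lam : {measure set Z -> \bar R}) (p : X -> Y -> Z) (f : Z -> \bar R) :
  (forall x, measurable_fun [set: Y] (p x)) ->
  (forall A, measurable A ->
    measurable_fun [set: X] (fun x => nu (p x @^-1` A))) ->
  (forall A, measurable A -> lam A = \int[mu]_x nu (p x @^-1` A)) ->
  measurable_fun [set: Z] f -> (forall z, 0 <= f z) ->
  \int[lam]_z f z = \int[mu]_x \int[nu]_y f (p x y).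
Proof.
move=> mp mnu lamE mf f0.
(* Bundling [p x] gives its [pushforward] a measure structure; these image measures form the
   kernel. *)
pose P x : {mfun Y >-> Z} :=
  HB.pack (p x) (isMeasurableFun.Build _ _ _ _ _ (mp x)).
rewrite (@ge0_integral_mixture _ _ _ _ _ mu lam
  (fun x => pushforward nu (P x) : {measure set Z -> \bar R}))//.
by apply: eq_integral => x _; rewrite ge0_integral_pushforward.
Qed.

Theorem theorem3p5 (dX dY : measure_display)
    (X : measurableType dX) (Y : measurableType dY) (R : realType)
    (mu : {measure set X -> \bar R}) (nu : {measure set Y -> \bar R})
    (hab : abelian_pair mu nu)
    (f : X * Y -> \bar R) (f_ge0 : forall z : X * Y, 0 <= f z)
    (mf : measurable_fun [set: X * Y] f) :
  \int[(abelian_product hab : {measure set (X * Y) -> \bar R})]_z f z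
    = \int[mu]_x \int[nu]_y f (x, y) /\
  \int[mu]_x \int[nu]_y f (x, y) = \int[nu]_y \int[mu]_x f (x, y).
Proof.
have intX : \int[(abelian_product hab : {measure set (X * Y) -> \bar R})]_z f z
    = \int[mu]_x \int[nu]_y f (x, y).
  apply: (ge0_integral_disintegration (p := pair)) => //.
  - by move=> A mA; under eq_fun do rewrite -xsectionE; have [] := hab A mA.
  - by move=> A mA; apply: eq_integral => x _; rewrite xsectionE.
rewrite -intX; split=> //.
(* The roles of [mu] and [nu] are exchanged; the equality of the two mixtures enters through
   [abelian_productE]. *)
apply: (ge0_integral_disintegration (p := fun y x => (x, y))) => //.
- by move=> A mA; under eq_fun do rewrite -ysectionE; have [] := hab A mA.
- move=> A mA; rewrite [LHS]abelian_productE//.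
  by apply: eq_integral => y _; rewrite ysectionE.
Qed.
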